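(* Consider a quantum system composed of finitely many subsystems, where subsystem $i$ has state space $\mathbb{C}^{d_i}$ with arbitrary finite dimension $d_i$, in a (pure or mixed) state with two-body reduced density matrices $\rho_{ij}$ for $i\neq j$. For each subsystem $i$ let $U_i$ be a unitary operator on $\mathbb{C}^{d_i}$, and let the transformed two-body density matrices be $$\tilde\rho_{ij}=(U_i\otimes U_j)\,\rho_{ij}\,(U_i^{\dagger}\otimes U_j^{\dagger}).$$ Let $\{a\}_K=(a_1,a_2,\ldots,a_K)$, $K\ge 2$, be a closed path of subsystems (consecutive ones distinct, including $a_K\ne a_1$, but subsystems otherwise allowed to repeat), and define $$\mathcal{P}(\{a\}_K)=\mathcal{R}(\rho_{a_1a_K}^{T_{a_K}})\,\mathcal{R}(\rho_{a_Ka_{K-1}}^{T_{a_{K-1}}})\cdots\mathcal{R}(\rho_{a_3a_2}^{T_{a_2}})\,\mathcal{R}(\rho_{a_2a_1}^{T_{a_1}}).$$ Then $$\mathcal{P}(\{a\}_K)=(U_{a_1}\otimes U_{a_1}^{*})^{\dagger}\;\mathcal{R}(\tilde\rho_{a_1a_K}^{T_{a_K}})\cdots\mathcal{R}(\tilde\rho_{a_3a_2}^{T_{a_2}})\,\mathcal{R}(\tilde\rho_{a_2a_1}^{T_{a_1}})\;(U_{a_1}\otimes U_{a_1}^{*}).$$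
   Context: A fixed orthonormal basis is chosen in each $\mathbb{C}^{d_i}$; all matrix entries, (partial) transposes and entrywise complex conjugates ($U^{*}$) are taken in these bases, and $\dagger$ is the conjugate transpose. For distinct subsystems $p,q$, $\rho_{pq}$ is the reduced density matrix of the pair, obtained by tracing out all other subsystems, acting on $\mathbb{C}^{d_p}\otimes\mathbb{C}^{d_q}$ with $p$ as the first factor. It is Hermitian, positive semidefinite and of trace $1$, and $(\rho_{pq})_{i\alpha;j\beta}=(\rho_{qp})_{\alpha i;\beta j}$, where $M_{i\alpha;j\beta}=\langle i|\langle\alpha|M|j\rangle|\beta\rangle$. Partial transpose on $q$: $(\rho_{pq}^{T_q})_{i\alpha;j\beta}=(\rho_{pq})_{i\beta;j\alpha}$. Realignment: for a matrix $M$ on $\mathbb{C}^{d_p}\otimes\mathbb{C}^{d_q}$, $\mathcal{R}(M)$ is the $d_p^2\times d_q^2$ matrix with rows indexed by pairs $(i,j)$, $1\le i,j\le d_p$, and columns indexed by pairs $(\alpha,\beta)$, $1\le\alpha,\beta\le d_q$, with entries $\mathcal{R}(M)_{ij;\alpha\beta}=M_{i\alpha;j\beta}$. Thus $\mathcal{R}(\rho_{pq}^{T_q})_{ij;\alpha\beta}=(\rho_{pq})_{i\beta;j\alpha}$. In particular $\mathcal{P}(\{a\}_K)$ is a $d_{a_1}^2\times d_{a_1}^2$ matrix, indexed by pairs in the same way as $U_{a_1}\otimes U_{a_1}^{*}$, i.e. $(A\otimes B)_{ij;kl}=A_{ik}B_{jl}$. *)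

(* Defs.v *)
From mathcomp Require Import all_boot all_order all_algebra.
From mathcomp Require Import mxtens complex reals.

Set Implicit Arguments.
Unset Strict Implicit.
Unset Printing Implicit Defensive.

Import GRing.Theory Num.Theory Num.Def.
Local Open Scope ring_scope.
Local Open Scope sesquilinear_scope.

(* Throughout, a basis vector |i>|alpha> of C^m (x) C^n has the index
   mxtens_index (i, alpha) : 'I_(m * n), as in the Kronecker product *t. *)

(* Basis of the tensor product of the C^(d i), i : S: one basis vector of each
   factor. *)
Notation config d := {dffun forall i, 'I_(d i)}.

Section TwoBody.
Context {C : numClosedFieldType}.

Definition density_matrix {n} (rho : 'M[C]_n) : Prop :=
  [/\ rho \is hermsymmx,
      forall v : 'cV[C]_n, 0 <= (v ^t* *m rho *m v) 0 0 &
      \tr rho = 1].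

Definition reduced2 {S : finType} {d : S -> nat} (rho : 'M[C]_#|config d|)
    (p q : S) : 'M[C]_(d p * d q) :=
  \matrix_(k, l)
    \sum_(x : config d | (x p, x q) == mxtens_unindex k)
    \sum_(y : config d | ((y p, y q) == mxtens_unindex l) &&
                         [forall r, (r != p) && (r != q) ==> (x r == y r)])
      rho (enum_rank x) (enum_rank y).

(* Partial transpose on the second factor. *)
Definition ptranspose {m n} (M : 'M[C]_(m * n)) : 'M[C]_(m * n) :=
  \matrix_(k, l)
    let: (i, alpha) := mxtens_unindex k in
    let: (j, beta) := mxtens_unindex l in
    M (mxtens_index (i, beta)) (mxtens_index (j, alpha)).

Definition realign {m n} (M : 'M[C]_(m * n)) : 'M[C]_(m * m, n * n) :=
  \matrix_(k, l)
    let: (i, j) := mxtens_unindex k in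
    let: (alpha, beta) := mxtens_unindex l in
    M (mxtens_index (i, alpha)) (mxtens_index (j, beta)).

Section Loop.
Context {S : Type} {d : S -> nat}.
Variable rho2 : forall p q : S, 'M[C]_(d p * d q).

Definition link p q : 'M[C]_(d p * d p, d q * d q) :=
  realign (ptranspose (rho2 p q)).

(* For s = [:: a_2; ..; a_K], the open product
   link a_K a_(K-1) *m ... *m link a_3 a_2 *m link a_2 a_1. *)
Fixpoint path_prod (a1 : S) (s : seq S) :
    'M[C]_(d (last a1 s) * d (last a1 s), d a1 * d a1) :=
  match s with
  | [::] => 1%:M
  | a2 :: s' => path_prod a2 s' *m link a2 a1
  end.

(* Closes the path (a_1, ..., a_K) = a1 :: s with the factor link a_1 a_K. *)
Definition loop_prod (a1 : S) (s : seq S) : 'M[C]_(d a1 * d a1) :=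
  link a1 (last a1 s) *m path_prod a1 s.

End Loop.
End TwoBody.

(* Main.v *)
(* With W p = U p *t (U p)^*, the realigned partial transpose turns the local
   conjugation by U p *t U q into link p q |-> W p *m link p q *m (W q)^t*:
   without the partial transpose, the factor on the right would be the transpose
   of W q, and the product would not telescope. The inner factors
   (W q)^t* *m W q cancel along the path, and closing it leaves only the
   outer conjugation by W a1. *)
Require Import Defs.
From mathcomp Require Import all_boot all_order all_algebra.
From mathcomp Require Import mxtens complex reals ring.

Set Implicit Arguments.
Unset Strict Implicit.
Unset Printing Implicit Defensive.

Import GRing.Theory Num.Theory Num.Def.
Local Open Scope ring_scope.
Local Open Scope sesquilinear_scope.

Section LinkUnitary.
Context {C : numClosedFieldType}.

Lemma sum_mxtens_index (V : nmodType) m n (F : 'I_(m * n) -> V) :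
  \sum_k F k = \sum_i \sum_j F (mxtens_index (i, j)).
Proof.
rewrite pair_bigA /= (reindex (@mxtens_index m n)) /=.
  by apply: eq_bigr => -[].
by exists (@mxtens_unindex m n) => k _; rewrite (mxtens_indexK, mxtens_unindexK).
Qed.

Lemma adj_tensmx m n p q (A : 'M[C]_(m, n)) (B : 'M[C]_(p, q)) :
  (A *t B)^t* = A^t* *t B^t*.
Proof. by rewrite trmx_tens map_mxT. Qed.

(** After both reshufflings, the entry at row [(i, j)] and column [(alpha, beta)] is the original
    one at row [(i, beta)] and column [(j, alpha)]. So [V] meets [beta] unconjugated and [alpha]
    conjugated, which is the pattern of the adjoint of [V *t map_mx conjC V]. *)
Lemma realign_ptranspose_tensmx m n (M : 'M[C]_(m * n))
    (U : 'M[C]_m) (V : 'M[C]_n) :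
  realign (ptranspose ((U *t V) *m M *m (U^t* *t V^t*))) =
    (U *t map_mx conjC U) *m realign (ptranspose M)
      *m (V *t map_mx conjC V)^t*.
Proof.
apply/matrixP=> k l; rewrite -(mxtens_unindexK k) -(mxtens_unindexK l).
case: (mxtens_unindex k) (mxtens_unindex l) => i j [alpha beta].
rewrite adj_tensmx mxE !mxtens_indexK mxE !mxtens_indexK.
(* Left side expanded: [(x1, y1)] and [(x2, y2)] are the column and row of [M]. *)
transitivity (\sum_x1 \sum_y1 \sum_x2 \sum_y2
   U i x2 * V beta y2 * M (mxtens_index (x2, y2)) (mxtens_index (x1, y1)) *
   ((U j x1)^* * (V alpha y1)^*)).
  rewrite mxE sum_mxtens_index; apply: eq_bigr => x1 _; apply: eq_bigr => y1 _.
  rewrite tensmxE !mxE sum_mxtens_index mulr_suml; apply: eq_bigr => x2 _.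
  by rewrite mulr_suml; apply: eq_bigr => y2 _; rewrite tensmxE.
(* Same terms in the order of the right side: the realigned matrix has row [(x2, x1)] and column
   [(y1, y2)]. *)
transitivity (\sum_y1 \sum_y2 \sum_x2 \sum_x1
   U i x2 * V beta y2 * M (mxtens_index (x2, y2)) (mxtens_index (x1, y1)) *
   ((U j x1)^* * (V alpha y1)^*)).
  rewrite exchange_big; apply: eq_bigr => y1 _.
  rewrite exchange_big /=.
  under eq_bigr do rewrite exchange_big /=.
  by rewrite exchange_big.
rewrite mxE sum_mxtens_index; apply: eq_bigr => y1 _; apply: eq_bigr => y2 _.
rewrite tensmxE !mxE sum_mxtens_index mulr_suml; apply: eq_bigr => x2 _.
rewrite mulr_suml; apply: eq_bigr => x1 _.
rewrite tensmxE !mxE !mxtens_indexK mxE !mxtens_indexK conjCK.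
ring.
Qed.

Lemma tens_conj_unitarymx m n (U : 'M[C]_(m, n)) :
  U \is unitarymx -> U *t map_mx conjC U \is unitarymx.
Proof.
move=> Uu; apply/unitarymxP; rewrite adj_tensmx tensmx_mul (unitarymxP Uu).
have /unitarymxP -> : map_mx conjC U \is unitarymx by rewrite conjC_unitary.
(* What remains is that a Kronecker product of identities is the identity: a product of two deltas
   is the delta of the pair. *)
by apply/matrixP=> k l; case: (mxtens_indexP k) => i j;
  case: (mxtens_indexP l) => x y; rewrite tensmxE !mxE -natrM mulnb
    (can_eq (@mxtens_indexK _ _)).
Qed.

Section Path.
Context {S : Type} {d : S -> nat}.
Variables (rho2 : forall p q : S, 'M[C]_(d p * d q)).
Variable U : forall p : S, 'M[C]_(d p).
Hypothesis unitaryU : forall p, U p \is unitarymx.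

Let W p := U p *t map_mx conjC (U p).
Let rho2' p q :=
  (U p *t U q) *m rho2 p q *m ((U p)^t* *t (U q)^t*).

Lemma link_unitary p q : link rho2' p q = W p *m link rho2 p q *m (W q)^t*.
Proof. exact: realign_ptranspose_tensmx. Qed.

(** An open path keeps one factor at each end. The induction is over all [a], since the tail starts
    at the next subsystem. *)
Lemma path_prod_unitary a s :
  path_prod rho2' a s = W (last a s) *m path_prod rho2 a s *m (W a)^t*.
Proof.
have Wu p : W p \is unitarymx by exact: tens_conj_unitarymx.
elim: s a => [|b s IHs] a /=; first by rewrite mulmx1 (unitarymxP (Wu a)).
by rewrite IHs link_unitary !mulmxA mulmxKtV.
Qed.

Lemma loop_prod_unitary a s :
  loop_prod rho2' a s = W a *m loop_prod rho2 a s *m (W a)^t*.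
Proof.
rewrite /loop_prod path_prod_unitary link_unitary !mulmxA mulmxKtV //.
exact: tens_conj_unitarymx.
Qed.

End Path.
End LinkUnitary.

Theorem proposition1 (R : realType) (S : finType) (d : S -> nat)
    (rho : 'M[R[i]]_#|config d|) (U : forall p : S, 'M[R[i]]_(d p))
    (a1 : S) (s : seq S) :
  density_matrix rho ->
  (forall p, U p \is unitarymx) ->
  (2 <= size (a1 :: s))%N ->
  cycle (fun p q => p != q) (a1 :: s) ->
  let rho2 p q := reduced2 rho p q in
  let rho2' p q :=
    (U p *t U q) *m rho2 p q *m ((U p) ^t* *t (U q) ^t*) in
  loop_prod rho2 a1 s =
    (U a1 *t map_mx conjC (U a1)) ^t* *m loop_prod rho2' a1 s
      *m (U a1 *t map_mx conjC (U a1)).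
Proof.
move=> _ unitaryU _ _ rho2 rho2'; rewrite (loop_prod_unitary rho2 unitaryU).
have Wu := tens_conj_unitarymx (unitaryU a1).
have WW : (U a1 *t map_mx conjC (U a1))^t* *m (U a1 *t map_mx conjC (U a1)) = 1%:M.
  (* Unitarity gives the product in the other order; for square matrices a right inverse is also a
     left inverse. *)
  by apply: mulmx1C; apply/unitarymxP.
by rewrite !mulmxA WW mul1mx -mulmxA WW mulmx1.
Qed.
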